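(* Fix a dynamic network $\mathcal G$ on $n$ nodes with vertex expansion $\alpha$, maximum degree $\Delta$, and stability factor at least $\tau$, where $1\le\tau\le\log\Delta$. Then the PPUSH algorithm solves rumor spreading in $\mathcal G$ in the mobile telephone model with $b=1$ within $O\big((1/\alpha)\,\Delta^{1/\tau}\,\tau\,\log^3 n\big)$ rounds, with high probability in $n$.
   Context: A dynamic graph $\mathcal G$ is a sequence of connected undirected graphs $G_1=(V,E_1),G_2=(V,E_2),\dots$ on a common node set $V$, $|V|=n$, with $G_j$ the topology in round $j$. Stability factor $\tau$: the sequence can be partitioned into consecutive intervals of $\tau$ rounds such that all graphs within an interval are identical. For a static graph, $\partial S=\{v\notin S:N(v)\cap S\ne\emptyset\}$, $\alpha(S)=|\partial S|/|S|$, vertex expansion $=\min_{0<|S|\le n/2}\alpha(S)$; the vertex expansion of $\mathcal G$ is the minimum over its graphs, and $\Delta$ is the maximum degree over all its graphs. Mobile telephone model with tag length $b$: in each round, each node first publishes a $b$-bit tag visible to all its current neighbors; then each node may send a connection proposal to at most one current neighbor; a node that sends a proposal cannot receive one; a node that sent no proposal and received at least one accepts at most one (possibly chosen adversarially); connected pairs exchange unbounded information. Rumor spreading: a single source starts with a rumor; solved when all nodes know it. PPUSH: at the start of each round each node uses its 1-bit tag to advertise whether it is informed (knows the rumor); each informed node with at least one uninformed neighbor chooses an uninformed neighbor uniformly at random and proposes a connection to send it the rumor. ''With high probability in $n$'' means with probability at least $1-n^{-c}$ for a constant $c\ge1$. *)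

(* Defs.v *)
From mathcomp Require Import all_boot all_order all_algebra.
From mathcomp Require Import boolp classical_sets reals exp.

Set Implicit Arguments.
Unset Strict Implicit.
Unset Printing Implicit Defensive.

Import Order.TTheory GRing.Theory Num.Theory.

Local Open Scope ring_scope.

Record cgraph (V : finType) := CGraph {
  edge :> rel V;
  edge_sym : symmetric edge;
  edge_irr : irreflexive edge;
  edge_conn : forall u v : V, connect edge u v
}.

(* [G t] is the topology of the (t+1)-st round: rounds are numbered from 0. *)
Definition dyngraph (V : finType) := nat -> cgraph V.

Definition stable (V : finType) (G : dyngraph V) (tau : nat) : Prop :=
  (0 < tau)%N /\ forall s t, (s %/ tau = t %/ tau)%N -> G s =2 G t.

(* Having stability factor tau' does not imply having stability factor tau for
   every tau < tau' (the intervals need not be aligned), hence the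
   existential. *)
Definition stability_at_least (V : finType) (G : dyngraph V) (tau : nat) : Prop :=
  exists2 tau' : nat, (tau <= tau')%N & stable G tau'.

Definition boundary (V : finType) (G : cgraph V) (S : {set V}) : {set V} :=
  [set v | v \notin S & [exists u, G v u && (u \in S)]].

(* The next three infima and suprema range over nonempty sets (as soon as V has
   at least two elements) that take finitely many values, so they are minima and
   maxima. *)
Definition vexpansion (R : realType) (V : finType) (G : cgraph V) : R :=
  inf [set x | exists S : {set V}, [/\ (0 < #|S|)%N,
         #|S|%:R <= #|V|%:R / 2 :> R & x = #|boundary G S|%:R / #|S|%:R]]%classic.

Definition dyn_vexpansion (R : realType) (V : finType) (G : dyngraph V) : R :=
  inf [set x | exists t, x = vexpansion R (G t)]%classic.

Definition dyn_maxdeg (R : realType) (V : finType) (G : dyngraph V) : R :=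
  sup [set x | exists t, x = (\max_(v : V) #|[set u | G t v u]|)%:R]%classic.

Definition log2 (R : realType) (x : R) : R := ln x / ln 2.

Section MobileTelephone.
Variables (V : finType) (b : nat).

(* What a node [v] sees after tags are published: the tags of its neighbours. *)
Definition view (G : cgraph V) (tag : V -> b.-tuple bool) (v : V) :
    V -> option (b.-tuple bool) :=
  fun u => if G v u then Some (tag u) else None.

(* [p v] is the recipient of the proposal sent by [v], if any. *)
Definition proposals := {ffun V -> option V}.

(* [a v] is the node whose proposal is accepted by [v], if any. *)
Definition acceptances := {ffun V -> option V}.

(* A node accepts exactly one proposal whenever it has sent none and received
   at least one; which one is left open. *)
Definition valid_acceptances (p : proposals) (a : acceptances) : Prop :=
  forall v, match a v with
            | Some u => p v = None /\ p u = Some v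
            | None => p v <> None \/ forall u, p u <> Some v
            end.

Definition linked (a : acceptances) (u v : V) : bool :=
  (a v == Some u) || (a u == Some v).

(* An adversary picks the acceptances of a round knowing the proposals of that
   round (head of the list) and of all previous rounds (most recent first). *)
Definition adversary := seq proposals -> acceptances.

Definition valid_adversary (adv : adversary) : Prop :=
  forall p h, valid_acceptances p (adv (p :: h)).

End MobileTelephone.

Section PPUSH.
Variables (R : realType) (V : finType).

Definition ppush_tag (informed : bool) : 1.-tuple bool := [tuple informed].

Definition ppush_targets (w : V -> option (1.-tuple bool)) : {set V} :=
  [set u | w u == Some (ppush_tag false)].

(* Probability that a node with view [w] makes the choice [o]. *)
Definition ppush_law (informed : bool) (w : V -> option (1.-tuple bool))
    (o : option V) : R :=
  let U := ppush_targets w in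
  if informed && (U != finset.set0)
  then (if o is Some u then (u \in U)%:R / #|U|%:R else 0)
  else (o == None)%:R.

(* Nodes choose independently, given the set [I] of informed nodes. *)
Definition ppush_round_law (G : cgraph V) (I : {set V}) (p : proposals V) : R :=
  \prod_(v : V)
    ppush_law (v \in I) (view G (fun u => ppush_tag (u \in I)) v) (p v).

Definition ppush_next (I : {set V}) (a : acceptances V) : {set V} :=
  I :|: [set v | [exists u, (u \in I) && linked a u v]].

Variables (G : dyngraph V) (adv : adversary V) (source : V).

(* Nodes informed after the rounds whose proposals are listed in [h], most
   recent first. *)
Fixpoint ppush_informed (h : seq (proposals V)) : {set V} :=
  if h is _ :: h' then ppush_next (ppush_informed h') (adv h)
  else [set source].

Fixpoint ppush_history_law (h : seq (proposals V)) : R :=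
  if h is p :: h'
  then ppush_history_law h'
       * ppush_round_law (G (size h')) (ppush_informed h') p
  else 1.

Definition ppush_Pr (T : nat) (E : pred (seq (proposals V))) : R :=
  \sum_(h : T.-tuple (proposals V) | E h) ppush_history_law h.

Definition ppush_solved (h : seq (proposals V)) : bool :=
  ppush_informed h == [set: V].

End PPUSH.

(* Main.v *)
Require Import Defs.
From mathcomp Require Import all_boot all_order all_algebra.
From mathcomp Require Import boolp classical_sets reals exp.
From mathcomp Require Import sequences ring lra zify.
(* Imported again, so that set lemmas refer to [{set V}], not to classical sets. *)
From mathcomp Require Import ssrfun fintype finset.

(* Whatever the adversary does, the informed set evolves as a Markov chain: it is
   enlarged by all the nodes that received a proposal. Let I be the informed set
   at the start of tau stable rounds. By expansion, a maximal matching M across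
   the cut has at least (alpha / 4) min(|I|, n - |I|) edges. Follow an edge (l, v)
   of M and call an uninformed node light if the expected number of proposals it
   receives is at most theta = 3 ln n; a node that is not light gets informed in
   the round except with probability n^-3. In each round, either a fraction at
   least 1/D of the uninformed neighbours of l is light, where D = 2 Delta^(1/tau),
   and then l can be credited with 1 / (D (1 + theta)) newly informed nodes in
   expectation; or with high probability the number of uninformed neighbours of l is
   divided by D. As Delta < D^tau, the latter cannot happen tau times without v
   being informed. Summing over M, the expected progress of the window is of order
   |M| / (D (1 + theta)), and hence (n - |I|) / |I| contracts in expectation by a
   factor 1 - q with q of order alpha / (Delta^(1/tau) log n). This quantity is
   initially n - 1, and at least 1 / n as long as some node is uninformed, so
   O(log n / q) windows suffice by Markov's inequality. *)

Set Implicit Arguments.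
Unset Strict Implicit.

Import Order.TTheory GRing.Theory Num.Theory.

Local Open Scope ring_scope.

(** * One round *)

(** Acceptances do not enter; [next_spread] identifies this set with [ppush_next] for proposals of
    nonzero probability. *)
Definition spread (V : finType) (I : {set V}) (p : proposals V) : {set V} :=
  I :|: [set v | [exists u, (u \in I) && (p u == Some v)]].

Definition frontier (V : finType) (G : cgraph V) (I : {set V}) (l : V) : {set V} :=
  [set u | G l u && (u \notin I)].

Section Round.
Variables (R : realType) (V : finType) (G : cgraph V).
Implicit Types (I J : {set V}) (p : proposals V) (f g : {set V} -> R).

Definition node_law I (l : V) : option V -> R :=
  ppush_law R (l \in I) (view G (fun u => ppush_tag (u \in I)) l).

Lemma node_lawE I l o : node_law I l o =
  if (l \in I) && (frontier G I l != set0)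
  then (if o is Some u then (u \in frontier G I l)%:R / #|frontier G I l|%:R
        else 0)
  else (o == None)%:R.
Proof.
rewrite /node_law /ppush_law.
have -> // : ppush_targets (view G (fun u => ppush_tag (u \in I)) l)
  = frontier G I l.
apply/setP => u; rewrite !inE /view.
by case: (G l u) => //=; case: (u \in I); rewrite ?eqxx.
Qed.

Lemma node_law_ge0 I l o : 0 <= node_law I l o.
Proof.
by rewrite node_lawE; case: ifP => // _; case: o => // u; rewrite divr_ge0.
Qed.

Lemma sum_option (F : option V -> R) :
  \sum_o F o = F None + \sum_u F (Some u).
Proof.
rewrite (bigD1 None) //=; congr (_ + _).
rewrite (reindex_omap Some id) /=; last by case.
by apply: eq_bigl => u; rewrite eqxx.
Qed.

Lemma sum_node_law I l : \sum_o node_law I l o = 1.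
Proof.
rewrite sum_option !node_lawE eqxx.
case: ifP => [lF|nF]; last first.
  by rewrite big1 ?addr0 // => u _; rewrite node_lawE nF.
rewrite add0r; under eq_bigr do rewrite node_lawE lF.
case/andP: lF => _ F0.
rewrite -mulr_suml -natr_sum.
have -> : (\sum_u (u \in frontier G I l) = #|frontier G I l|)%N.
  by rewrite -sum1_card [RHS]big_mkcond; apply: eq_bigr => u _; case: (_ \in _).
by rewrite divff // pnatr_eq0 cards_eq0.
Qed.

(** Independence of the choices: by distributivity, the expectation of a product over nodes
    factors. *)
Lemma sum_round_law I (g : V -> option V -> R) :
  \sum_p ppush_round_law R G I p * \prod_l g l (p l)
  = \prod_l \sum_o node_law I l o * g l o.
Proof.
rewrite bigA_distr_bigA; apply: eq_bigr => p _.
by rewrite -big_split.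
Qed.

Lemma round_law_ge0 I p : 0 <= ppush_round_law R G I p.
Proof. by apply: prodr_ge0 => l _; apply: node_law_ge0. Qed.

(** Transition operator of the Markov chain, acting on functions; expectations over several rounds
    are its compositions. *)
Definition ppush_step f I : R :=
  \sum_p ppush_round_law R G I p * f (spread I p).

Lemma ppush_step_const (a : R) I : ppush_step (fun=> a) I = a.
Proof.
rewrite /ppush_step -mulr_suml.
suff -> : \sum_p ppush_round_law R G I p = 1 by rewrite mul1r.
transitivity (\sum_p ppush_round_law R G I p * \prod_(l : V) 1).
  by apply: eq_bigr => p _; rewrite big1_eq mulr1.
rewrite (sum_round_law I (fun _ _ => 1)) big1 // => l _.
by under eq_bigr do rewrite mulr1; apply: sum_node_law.
Qed.

Lemma ppush_stepD f g I :
  ppush_step (fun J => f J + g J) I = ppush_step f I + ppush_step g I.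
Proof. by rewrite -big_split; apply: eq_bigr => p _; rewrite mulrDr. Qed.

Lemma ppush_stepZ (a : R) f I :
  ppush_step (fun J => a * f J) I = a * ppush_step f I.
Proof. by rewrite mulr_sumr; apply: eq_bigr => p _; rewrite mulrCA. Qed.

Lemma ppush_step_sum (T : Type) (s : seq T) (P : pred T)
    (F : T -> {set V} -> R) I :
  ppush_step (fun J => \sum_(i <- s | P i) F i J) I
  = \sum_(i <- s | P i) ppush_step (F i) I.
Proof. by rewrite exchange_big; apply: eq_bigr => p _; rewrite mulr_sumr. Qed.

Lemma sub_spread I p : I \subset spread I p.
Proof. exact: subsetUl. Qed.

(** Each informed node addresses at most one node. *)
Lemma card_spread I p : (#|spread I p| <= 2 * #|I|)%N.
Proof.
rewrite mul2n -addnn (leq_trans (leq_card_setU _ _)) // leq_add2l.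
apply: leq_trans (leq_imset_card p I).
have injS : injective (@Some V) by move=> x y [].
rewrite -(card_imset _ injS); apply: subset_leq_card.
apply/subsetP => _ /imsetP[v + ->]; rewrite inE => /existsP[u /andP[uI /eqP <-]].
exact: imset_f.
Qed.

Lemma le_ppush_step f g I :
  (forall J, I \subset J -> (#|J| <= 2 * #|I|)%N -> f J <= g J) ->
  ppush_step f I <= ppush_step g I.
Proof.
move=> fg; apply: ler_sum => p _.
by rewrite ler_wpM2l ?round_law_ge0 // fg ?sub_spread ?card_spread.
Qed.

(* The expected number of proposals received by [u]. *)
Definition pull I (u : V) : R :=
  \sum_(l in I | G l u) #|frontier G I l|%:R^-1.

Lemma notin_spread I p u : u \notin I ->
  (u \notin spread I p)%:R
  = \prod_l (if l \in I then (p l != Some u)%:R else 1) :> R.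
Proof.
move=> uI; rewrite !inE (negbTE uI) /= negb_exists.
case: forallP => [H|/forallP]; rewrite -?big_mkcond /=.
  by rewrite big1 // => l lI; have := H l; rewrite lI /= => ->.
rewrite negb_forall => /existsP[l]; rewrite negbK => /andP[lI /eqP pl].
by rewrite (bigD1 l) //= pl eqxx mul0r.
Qed.

(** By independence, each informed neighbour [l] contributes a factor [1 - 1 / #|frontier G I l|],
    and [1 - x <= expR (- x)]. *)
Lemma miss_le I u : u \notin I ->
  ppush_step (fun J => (u \notin J)%:R) I <= expR (- pull I u).
Proof.
move=> uI; rewrite /ppush_step.
under eq_bigr do rewrite notin_spread //.
rewrite (sum_round_law I (fun l o => if l \in I then (o != Some u)%:R else 1)).
rewrite /pull -sumrN expR_sum [leRHS]big_mkcond /=.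
apply: ler_prod => l _; apply/andP; split.
  by apply: sumr_ge0 => o _; rewrite mulr_ge0 ?node_law_ge0 //; case: ifP.
case: (boolP (l \in I)) => lI /=; last first.
  by under eq_bigr do rewrite mulr1; rewrite sum_node_law.
case: (boolP (G l u)) => Glu; last first.
  rewrite -[leRHS](sum_node_law I l) ler_sum // => o _.
  by case: (o != Some u); rewrite ?mulr1 ?mulr0 ?node_law_ge0.
have ul : u \in frontier G I l by rewrite inE Glu uI.
have -> : \sum_o node_law I l o * (o != Some u)%:R
  = 1 - #|frontier G I l|%:R^-1.
  rewrite -[X in _ = X - _](sum_node_law I l) [in RHS](bigD1 (Some u)) //=.
  rewrite [in LHS](bigD1 (Some u)) //= eqxx mulr0 add0r.
  rewrite node_lawE lI ul mul1r ifT; last by apply/set0Pn; exists u.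
  rewrite addrAC subrr add0r; apply: eq_bigr => o ou; by rewrite ou mulr1.
by rewrite expR_ge1Dx.
Qed.

End Round.

(** * Expected progress of one round *)

Section Window.
Variables (R : realType) (V : finType) (G : cgraph V).
Implicit Types (I J : {set V}) (f g : {set V} -> R).

Lemma pull_ge0 I (u : V) : 0 <= pull R G I u.
Proof. by apply: sumr_ge0 => l _; rewrite invr_ge0. Qed.

Lemma card_spread_gain I :
  \sum_(u | u \notin I) (1 - expR (- pull R G I u))
  <= ppush_step G (fun J => #|J|%:R) I - #|I|%:R.
Proof.
rewrite lerBrDl.
have le1 : ppush_step G (fun J => #|I|%:R +
    \sum_(u | u \notin I) (1 + -1 * (u \notin J)%:R)) I
    <= ppush_step G (fun J => #|J|%:R : R) I.
  apply: le_ppush_step => J IJ _.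
  rewrite -(cardsID I J) natrD (setIidPr IJ) lerD2l.
  rewrite -sum1_card natr_sum [leRHS]big_mkcond [leLHS]big_mkcond /=.
  apply: ler_sum => u _; rewrite !inE.
  by case: (u \in I); case: (u \in J); rewrite /= ?mulr0 ?mulr1 ?addr0 ?subrr.
apply: le_trans le1.
rewrite ppush_stepD ppush_step_const lerD2l ppush_step_sum.
apply: ler_sum => u uI.
rewrite ppush_stepD ppush_step_const ppush_stepZ mulN1r lerD2l lerN2.
exact: miss_le.
Qed.

(* [gain I l] bounds from below the share of [l] in the expected number of newly
   informed nodes: a node pulled by [w <= theta] is informed with probability at
   least [1 - expR (- w) >= w / (1 + theta)], and [l] contributes
   [1 / #|frontier I l|] to that [w]. *)
Definition light (theta : R) I (l : V) : {set V} :=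
  [set u in frontier G I l | pull R G I u <= theta].

Definition gain (theta : R) I (l : V) : R :=
  #|light theta I l|%:R / #|frontier G I l|%:R / (1 + theta).

Lemma gain_ge0 theta I l : 0 <= theta -> 0 <= gain theta I l.
Proof. by move=> t0; rewrite !divr_ge0 // addr_ge0. Qed.

Lemma sum_gain_le theta I : 0 <= theta ->
  \sum_(l in I) gain theta I l
  <= ppush_step G (fun J => #|J|%:R) I - #|I|%:R.
Proof.
move=> t0; apply: le_trans (card_spread_gain I).
have t1 : 0 < 1 + theta by rewrite ltr_wpDr.
(* Double counting: contributions are regrouped by receiving node, heavy nodes counting for 0. *)
have -> : \sum_(l in I) gain theta I l = \sum_(u | u \notin I)
    (if pull R G I u <= theta then pull R G I u / (1 + theta) else 0).
  rewrite /gain -mulr_suml.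
  under eq_bigr => l _.
    rewrite -sum1_card natr_sum mulr_suml.
    under eq_bigl do rewrite !inE.
    over.
  rewrite (exchange_big_dep (fun u => (u \notin I) && (pull R G I u <= theta))) /=;
    last by move=> l u _ /andP[/andP[_ ->] ->].
  rewrite mulr_suml big_mkcondr; apply: eq_bigr => u uI.
  case: ifP => // ut; congr (_ / _).
  by apply: eq_big => [l|l _]; rewrite ?div1r // uI ut !andbT.
apply: ler_sum => u _.
have w0 := pull_ge0 I u; set w := pull R G I u in w0 *.
have w1 : 0 < 1 + w by rewrite ltr_wpDr.
apply: (@le_trans _ _ (w / (1 + w))).
  case: ifP => [wt|_]; last by rewrite divr_ge0 // ltW.
  by rewrite ler_wpM2l // lef_pV2 // lerD2l.
have -> : w / (1 + w) = 1 - (1 + w)^-1.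
  by field; rewrite lt0r_neq0.
by rewrite expRN lerD2l lerN2 lef_pV2 ?posrE ?expR_gt0 // expR_ge1Dx.
Qed.

Definition inv_card J : R := #|J|%:R^-1.

(** Growing from [i] to [j] nodes lowers the reciprocal by [(j - i) / (i * j)]. Here [i <= 2 * i0]
    and [j <= 2 * i], hence the constant 8. *)
Lemma inv_card_step_gain theta I (i0 : nat) : 0 <= theta ->
  (0 < #|I|)%N -> (#|I| <= 2 * i0)%N ->
  \sum_(l in I) gain theta I l
  <= 8 * i0%:R ^+ 2 * (inv_card I - ppush_step G inv_card I).
Proof.
move=> t0 I0 Ii.
have i0gt0 : 0 < i0%:R :> R by rewrite ltr0n; lia.
have A0 : 0 < 8 * i0%:R ^+ 2 :> R by rewrite mulr_gt0 ?exprn_gt0.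
apply: le_trans (sum_gain_le I t0) _.
rewrite -ler_pdivrMl // lerBrDl -lerBrDr.
have le1 : ppush_step G inv_card I <= ppush_step G (fun J => inv_card I +
   (8 * i0%:R ^+ 2)^-1 * (#|I|%:R + -1 * #|J|%:R)) I.
  apply: le_ppush_step => J IJ JI; rewrite /inv_card.
  have := subset_leq_card IJ; move: I0 Ii JI {IJ}.
  move: #|I| #|J| => i j i0' ii ji ij.
  have ip : 0 < i%:R :> R by rewrite ltr0n.
  have jp : 0 < j%:R :> R by rewrite ltr0n; lia.
  rewrite mulN1r -lerBlDl -opprB -[leRHS]opprK lerN2 -mulrN opprB.
  have -> : i%:R^-1 - j%:R^-1 = (i%:R * j%:R)^-1 * (j%:R - i%:R) :> R.
    by field; rewrite !lt0r_neq0.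
  rewrite ler_wpM2r ?subr_ge0 ?ler_nat // lef_pV2 ?posrE ?mulr_gt0 //.
  by rewrite -natrX -!natrM ler_nat; nia.
apply: le_trans le1 _.
rewrite ppush_stepD ppush_step_const ppush_stepZ ppush_stepD ppush_step_const.
by rewrite ppush_stepZ mulN1r; lra.
Qed.

Lemma inv_card_step_le I : (0 < #|I|)%N -> ppush_step G inv_card I <= inv_card I.
Proof.
move=> I0; rewrite -[leRHS](ppush_step_const G _ I).
apply: le_ppush_step => J IJ _.
have := subset_leq_card IJ => ij.
by rewrite /inv_card lef_pV2 ?posrE ?ltr0n ?ler_nat //; apply: leq_trans ij.
Qed.

End Window.
Arguments inv_card R {V} J.

(** * A stable window *)

Section Value.
Variables (R : realType) (V : finType) (G : cgraph V).
Variables (theta beta : R) (i0 : nat).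
Hypotheses (theta0 : 0 <= theta) (beta0 : 0 <= beta).
Implicit Types (I J : {set V}) (f g : {set V} -> R).

Definition settled (v : V) I : bool := (v \in I) || (2 * i0 < #|I|)%N.

(* Expected reward over [k] rounds of a pair [(l, v)] matched across the initial
   cut. Growth beyond twice the initial size [i0] counts as success, because the
   gains are measured at the scale [i0]. *)
Fixpoint value k (l v : V) I : R :=
  if k is k'.+1
  then gain G theta I l * (#|I| <= 2 * i0)%N%:R + ppush_step G (value k' l v) I
  else beta * (settled v I)%:R.

Lemma value_ge0 k l v I : 0 <= value k l v I.
Proof.
elim: k I => [|k IH] I /=; first by rewrite mulr_ge0.
apply: addr_ge0; first by rewrite mulr_ge0 ?gain_ge0.
by rewrite -[leLHS](ppush_step_const G _ I); apply: le_ppush_step.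
Qed.

(* In each round, either a fraction [1 / D] of the frontier of [l] is light and
   [l] gains at least [beta], or with high probability every heavy node gets
   informed and the frontier of [l] shrinks by a factor [D]. After [k] rounds of
   shrinking nothing is left of it, so [v] is informed. *)
Lemma value_ge (D : R) k l v I : 0 < D ->
  beta <= (D * (1 + theta))^-1 ->
  l \in I -> G l v ->
  settled v I || (#|frontier G I l|%:R < D ^+ k) ->
  beta * (1 - k%:R * (#|V|%:R * expR (- theta))) <= value k l v I.
Proof.
move=> D0 bD lI Glv; set eps := #|V|%:R * _.
have eps0 : 0 <= eps by rewrite mulr_ge0 ?expR_ge0.
have t1 : 0 < 1 + theta by rewrite ltr_wpDr.
elim: k I lI => [|k IH] I lI.
  rewrite mul0r subr0 mulr1 expr0 /=.
  case: (boolP (settled v I)) => [_ _|]; first by rewrite mulr1.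
  (* A frontier of size below 1 is empty, yet it contains [v]. *)
  rewrite /settled negb_or /= (ltr_nat _ _ 1) ltnS leqn0 cards_eq0 => /andP[vI _] /eqP F0.
  by have := in_set0 v; rewrite -F0 inE Glv vI.
have epsS : beta * (1 - k.+1%:R * eps) <= beta * (1 - k%:R * eps).
  by rewrite ler_wpM2l // lerD2l lerN2 ler_wpM2r // ler_nat.
have gain_nneg : 0 <= gain G theta I l * (#|I| <= 2 * i0)%N%:R.
  by rewrite mulr_ge0 ?gain_ge0.
case: (boolP (settled v I)) => [dI _|].
  rewrite /= (le_trans epsS) // -[leLHS]add0r lerD //.
  rewrite -[leLHS](ppush_step_const G _ I); apply: le_ppush_step => J IJ _.
  apply: IH; first exact: subsetP lI.
  move: dI; rewrite /settled => /orP[/(subsetP IJ) -> //|Ii].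
  by rewrite (leq_trans Ii (subset_leq_card IJ)) orbT.
rewrite /settled negb_or -leqNgt => /andP[vI Ii] /= dD; rewrite Ii mulr1.
set F := frontier G I l in dD *; set L := light G theta I l.
have d0 : 0 < #|F|%:R :> R.
  by rewrite ltr0n card_gt0; apply/set0Pn; exists v; rewrite inE Glv.
have LF : L \subset F by apply/subsetP => u; rewrite inE => /andP[].
have [goodl|badl] := leP D^-1 (#|L|%:R / #|F|%:R).
  rewrite -[leLHS]addr0 lerD //; last first.
    by rewrite -[leLHS](ppush_step_const G _ I); apply: le_ppush_step => *; apply: value_ge0.
  apply: (@le_trans _ _ beta).
    by rewrite ler_piMr // gerBl mulr_ge0.
  by rewrite (le_trans bD) // /gain invfM ler_wpM2r // invr_ge0 ltW.
rewrite -[leLHS]add0r lerD ?gain_ge0 //.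
(* Each missed heavy node costs [beta]. If none is missed, the new frontier lies in [L] and
   induction applies; otherwise [h J <= 0]. *)
pose h J : R := beta * (1 - k%:R * eps)
   + - beta * \sum_(u in F :\: L) (u \notin J)%:R.
apply: (@le_trans _ _ (ppush_step G h I)); last first.
  apply: le_ppush_step => J IJ _; rewrite /h.
  have [HJ|] := boolP (F :\: L \subset J).
    rewrite big1 ?mulr0 ?addr0; last first.
      by move=> u uH; rewrite (subsetP HJ).
    apply: IH; first exact: subsetP lI.
    have FJ : frontier G J l \subset L.
      apply/subsetP => u; rewrite inE => /andP[Glu uJ].
      have uF : u \in F by rewrite inE Glu; apply: contra uJ; apply: subsetP.
      by apply: contraNT uJ => uL; rewrite (subsetP HJ) // inE uL.
    apply/orP; right; apply: (@le_lt_trans _ _ #|L|%:R).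
      by rewrite ler_nat subset_leq_card.
    move: badl; rewrite ltr_pdivrMr // mulrC ltr_pdivlMr // => badl.
    by rewrite -(ltr_pM2r D0) -exprSr (lt_trans badl).
  case/subsetPn => u uH uJ; apply: le_trans (value_ge0 k l v J).
  rewrite mulNr -mulrBr mulr_ge0_le0 // subr_le0 (bigD1 u) //= uJ.
  apply: (@le_trans _ _ 1); first by rewrite gerBl mulr_ge0.
  by rewrite lerDl sumr_ge0.
rewrite /h ppush_stepD ppush_step_const ppush_stepZ ppush_step_sum.
rewrite mulNr -mulrBr ler_wpM2l // -addrA lerD2l -opprD lerN2.
rewrite -addn1 natrD mulrDl mul1r lerD2l.
(* Union bound over the heavy nodes. *)
apply: (@le_trans _ _ (\sum_(u in F :\: L) expR (- theta))).
  apply: ler_sum => u; rewrite !inE => /andP[+ /andP[Glu uI]].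
  rewrite Glu uI /= -ltNge => tu.
  by apply: (le_trans (miss_le _ _ uI)); rewrite ler_expR lerN2 ltW.
rewrite sumr_const -mulr_natl ler_wpM2r ?expR_ge0 // ler_nat.
exact: max_card.
Qed.

(** The expected decrease of [inv_card] pays for all rewards. The gains of successive rounds
    telescope, since the left ends of [M] are distinct; the last term pays for the final rewards. *)
Lemma sum_value_le (M : {set V * V}) (I0 : {set V}) k I :
  beta <= 1 -> i0 = #|I0| -> (0 < i0)%N ->
  (forall e, e \in M -> (e.1 \in I0) && (e.2 \notin I0)) ->
  {in M &, injective fst} -> {in M &, injective snd} ->
  I0 \subset I ->
  \sum_(e in M) value k e.1 e.2 I
  <= 8 * i0%:R ^+ 2 * (inv_card R I - iter k (ppush_step G) (inv_card R) I)
   + 2 * i0%:R ^+ 2 * (i0%:R^-1 - iter k (ppush_step G) (inv_card R) I).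
Proof.
move=> b1 i0E i0gt0 MI M1 M2; elim: k I => [|k IH] I I0I.
  rewrite /= subrr mulr0 add0r -mulr_sumr.
  have ij := subset_leq_card I0I; rewrite -i0E in ij.
  have ip : 0 < i0%:R :> R by rewrite ltr0n.
  have jp : 0 < #|I|%:R :> R by rewrite ltr0n; lia.
  rewrite -natr_sum.
  set s := (\sum_(e in M) _)%N.
  have -> : 2 * i0%:R ^+ 2 * (i0%:R^-1 - inv_card R I)
     = 2 * i0%:R * (#|I|%:R - i0%:R) / #|I|%:R :> R.
    by rewrite /inv_card; field; rewrite !lt0r_neq0.
  apply: (@le_trans _ _ s%:R); first by rewrite ler_piMl.
  rewrite ler_pdivlMr // -natrB // -!natrM ler_nat.
  (* Up to size [2 * i0], settled pairs have distinct newly informed right ends, so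
     [s <= #|I| - i0]. Beyond it, [s <= #|M| <= i0] suffices because the reciprocal has at least
     halved. *)
  have [Ii|iI] := leqP #|I| (2 * i0).
    have sle : (s <= #|I| - i0)%N.
      have -> : (#|I| - i0 = #|I :\: I0|)%N by rewrite cardsD (setIidPr I0I) i0E.
      have -> : s = #|[set e in M | e.2 \in I]|.
        rewrite /s -sum1_card [LHS]big_mkcond [RHS]big_mkcond; apply: eq_bigr => e _.
        by rewrite inE /settled ltnNge Ii orbF; case: (e \in M); case: (_ \in I).
      rewrite -(card_in_imset (f := snd)); last first.
        by move=> e e'; rewrite !inE => /andP[eM _] /andP[eM' _]; apply: M2.
      apply/subset_leq_card/subsetP => _ /imsetP[e + ->].
      rewrite !inE => /andP[eM ->]; rewrite andbT.
      by case/andP: (MI _ eM).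
    by apply: leq_trans (leq_mul sle Ii) _; rewrite mulnC.
  have sle : (s <= i0)%N.
    rewrite i0E (@leq_trans #|M|) //.
      by rewrite -sum1_card /s leq_sum // => e _; case: settled.
    rewrite -(card_in_imset M1); apply/subset_leq_card/subsetP => _ /imsetP[e eM ->].
    by case/andP: (MI _ eM).
  nia.
rewrite /= big_split /= -ppush_step_sum.
have Ipos : (0 < #|I|)%N by rewrite (leq_trans i0gt0) // i0E subset_leq_card.
have step1 : \sum_(e in M) gain G theta I e.1 * (#|I| <= 2 * i0)%N%:R
   <= 8 * i0%:R ^+ 2 * (inv_card R I - ppush_step G (inv_card R) I).
  case: (leqP #|I| (2 * i0)) => Ii; last first.
    rewrite big1; last by move=> *; rewrite mulr0.
    by rewrite mulr_ge0 // ?mulr_ge0 ?exprn_ge0 // subr_ge0 inv_card_step_le.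
  apply: le_trans (inv_card_step_gain G theta0 Ipos Ii).
  under eq_bigr do rewrite mulr1.
  rewrite -(big_imset (gain G theta I)) //=.
  rewrite [leRHS](bigID (mem (fst @: M))) /= -[leLHS]addr0 lerD //; last first.
    by apply: sumr_ge0 => l _; apply: gain_ge0.
  rewrite le_eqVlt; apply/orP; left; apply/eqP/eq_bigl => l.
  case: imsetP => [[e eM ->]|]; rewrite ?andbF // andbT.
  by rewrite (subsetP I0I) //; case/andP: (MI _ eM).
have step2 : ppush_step G (fun J => \sum_(e in M) value k e.1 e.2 J) I <=
  ppush_step G (fun J =>
     8 * i0%:R ^+ 2 * (inv_card R J + -1 * iter k (ppush_step G) (inv_card R) J)
   + 2 * i0%:R ^+ 2 * (i0%:R^-1 + -1 * iter k (ppush_step G) (inv_card R) J)) I.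
  apply: le_ppush_step => J IJ _; rewrite !mulN1r; apply: IH.
  exact: subset_trans IJ.
move: step2; rewrite ppush_stepD !ppush_stepZ !ppush_stepD ppush_step_const !ppush_stepZ.
by lra.
Qed.
End Value.

(** * Matchings across the cut and contraction over a window *)

Section Matching.
Variables (R : realType) (V : finType) (G : cgraph V).
Implicit Types (I S : {set V}) (M : {set V * V}).

Definition cut_matching I M :=
  [&& [forall e in M, [&& e.1 \in I, e.2 \notin I & G e.1 e.2]],
      #|fst @: M| == #|M| & #|snd @: M| == #|M|].

Lemma cut_matchingP I M : reflect
  [/\ forall e, e \in M -> [&& e.1 \in I, e.2 \notin I & G e.1 e.2],
      {in M &, injective fst} & {in M &, injective snd}] (cut_matching I M).
Proof.
apply: (iffP and3P) => [[/forall_inP H /imset_injP H1 /imset_injP H2] //|[H H1 H2]].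
by split; [apply/forall_inP | apply/imset_injP | apply/imset_injP].
Qed.

Lemma maximal_cut_matching I : exists2 M, cut_matching I M &
  forall l u, l \in I -> u \notin I -> G l u -> (l \in fst @: M) || (u \in snd @: M).
Proof.
have P0 : cut_matching I set0.
  by apply/cut_matchingP; split => [e|e e'|e e']; rewrite inE.
have [M /maxsetP[PM maxM] _] := maxset_exists P0.
exists M => // l u lI uI Glu; apply: contraT; rewrite negb_or => /andP[lM uM].
suff PeM : cut_matching I ((l, u) |: M).
  have eM := maxM _ PeM (subsetUr _ _).
  case/negP: lM; apply/imsetP; exists (l, u) => //.
  by rewrite -eM setU11.
have /cut_matchingP[H H1 H2] := PM.
apply/cut_matchingP; split.
- by move=> e /setU1P[->|/H //]; rewrite /= lI uI.
- move=> e e' /setU1P[->|eM] /setU1P[->|eM'] //= E.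
  + by case/negP: lM; rewrite E imset_f.
  + by case/negP: lM; rewrite -E imset_f.
  + exact: H1.
- move=> e e' /setU1P[->|eM] /setU1P[->|eM'] //= E.
  + by case/negP: uM; rewrite E imset_f.
  + by case/negP: uM; rewrite -E imset_f.
  + exact: H2.
Qed.

(** Let [S] be the smaller side and [C] its matched nodes. By maximality the boundary of [S :\: C]
    consists of matched nodes, so [alpha * #|S :\: C| <= 2 * #|M|]; the bound [alpha <= 2] handles
    [C]. *)
Lemma expansion_cut_matching (alpha : R) I :
  alpha <= 2 ->
  (forall S, (0 < #|S|)%N -> (2 * #|S| <= #|V|)%N ->
     alpha * #|S|%:R <= #|boundary G S|%:R) ->
  exists2 M, cut_matching I M &
    alpha * (minn #|I| (#|V| - #|I|))%:R <= 4 * #|M|%:R.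
Proof.
move=> a2 exG; have [M MI Mcov] := maximal_cut_matching I.
exists M => //; have /cut_matchingP[MIE M1 M2] := MI.
set A := fst @: M in Mcov *; set B := snd @: M in Mcov *.
have cA : #|A| = #|M| by rewrite card_in_imset.
have cB : #|B| = #|M| by rewrite card_in_imset.
have AI : A \subset I.
  by apply/subsetP => _ /imsetP[e /MIE/and3P[? _ _] ->].
have BI : B \subset ~: I.
  by apply/subsetP => _ /imsetP[e /MIE/and3P[_ ? _] ->]; rewrite inE.
have side (S C : {set V}) : C \subset S -> #|C| = #|M| ->
    (2 * #|S| <= #|V|)%N -> boundary G (S :\: C) \subset A :|: B ->
    alpha * #|S|%:R <= 4 * #|M|%:R.
  move=> CS cC S2 bd.
  have SE : #|S|%:R = #|S :\: C|%:R + #|M|%:R :> R.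
    by rewrite -natrD -cC -(cardsID C S) (setIidPr CS) addnC.
  have : alpha * #|S :\: C|%:R <= 2 * #|M|%:R.
    have [->|S0] := posnP #|S :\: C|; first by rewrite mulr0 mulr_ge0.
    apply: (le_trans (exG _ S0 _)).
      by rewrite (leq_trans _ S2) // leq_mul2l subset_leq_card ?subsetDl.
    rewrite -natrM ler_nat (leq_trans (subset_leq_card bd)) //.
    by rewrite (leq_trans (leq_card_setU _ _)) // cA cB; lia.
  have : alpha * #|M|%:R <= 2 * #|M|%:R by rewrite ler_wpM2r.
  by rewrite SE; lra.
have cI : #|~: I| = (#|V| - #|I|)%N by rewrite cardsCs setCK.
have nI := max_card (mem I).
have [In|nI'] := leqP #|I| (#|V| - #|I|).
  apply: side AI cA _ _; first by lia.
  apply/subsetP => v; rewrite !inE => /andP[vS /existsP[u]].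
  rewrite !inE => /andP[Gvu /andP[uA uI]].
  have [vI|vI] := boolP (v \in I); first by move: vS; rewrite vI andbT negbK => ->.
  by have := Mcov u v uI vI; rewrite edge_sym Gvu (negbTE uA) => /(_ isT) /= ->; rewrite orbT.
rewrite -cI; apply: side BI cB _ _; first by lia.
apply/subsetP => v; rewrite !inE => /andP[vS /existsP[u]].
rewrite !inE => /andP[Gvu /andP[uB uI]].
have [vI|vI] := boolP (v \in I); last by move: vS; rewrite vI andbT negbK => ->; rewrite orbT.
by have := Mcov v u vI uI Gvu; rewrite (negbTE uB) orbF => ->.
Qed.

(* The number of uninformed nodes divided by the number of informed ones. *)
Definition ratio_uninformed I : R := #|V|%:R * inv_card R I - 1.

Lemma iter_ratio k I : iter k (ppush_step G) ratio_uninformed I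
  = #|V|%:R * iter k (ppush_step G) (inv_card R) I - 1.
Proof.
elim: k I => [//|k IH] I; rewrite !iterS.
have -> : iter k (ppush_step G) ratio_uninformed =
    fun J => #|V|%:R * iter k (ppush_step G) (inv_card R) J + -1.
  by apply/funext => J; rewrite IH.
by rewrite ppush_stepD ppush_stepZ ppush_step_const.
Qed.

Lemma window_contracts (alpha theta D : R) k I :
  0 <= alpha <= 2 -> 0 <= theta -> 1 <= D ->
  (forall S, (0 < #|S|)%N -> (2 * #|S| <= #|V|)%N ->
     alpha * #|S|%:R <= #|boundary G S|%:R) ->
  (forall l, #|[set u | G l u]|%:R < D ^+ k) ->
  k%:R * (#|V|%:R * expR (- theta)) <= 2^-1 ->
  (0 < #|I|)%N ->
  iter k (ppush_step G) ratio_uninformed I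
  <= (1 - alpha / (80 * (D * (1 + theta)))) * ratio_uninformed I.
Proof.
move=> /andP[a0 a2] t0 D1 exG degD keps I0.
have [M /cut_matchingP[MI M1 M2] aM] := expansion_cut_matching I a2 exG.
have DP : 0 < D * (1 + theta) by rewrite mulr_gt0 // ?ltr_wpDr // (lt_le_trans _ D1).
pose beta := (D * (1 + theta))^-1.
have b0 : 0 <= beta by rewrite invr_ge0 ltW.
have b1 : beta <= 1 by rewrite invf_le1 // -[leLHS]mulr1 ler_pM // lerDl.
have lower : #|M|%:R * (beta / 2) <=
    \sum_(e in M) value G theta beta #|I| k e.1 e.2 I.
  rewrite mulr_natl -sumr_const; apply: ler_sum => e /MI/and3P[lI uI Glu].
  apply: le_trans (value_ge (D := D) t0 b0 _ _ lI Glu _) => //.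
  - by rewrite ler_wpM2l //; lra.
  - by rewrite (lt_le_trans _ D1).
  apply/orP; right; apply: le_lt_trans (degD e.1).
  by rewrite ler_nat subset_leq_card //; apply/subsetP => u; rewrite !inE => /andP[].
have MI' e : e \in M -> (e.1 \in I) && (e.2 \notin I).
  by move=> /MI /and3P[-> ->].
have upper := sum_value_le G t0 b0 k b1 erefl I0 MI' M1 M2 (subxx I).
have {lower upper} := le_trans lower upper.
rewrite iter_ratio /ratio_uninformed.
have nI : (#|I| <= #|V|)%N := max_card (mem I).
set x := iter _ _ _ _; rewrite /inv_card => xP.
have -> : alpha / (80 * (D * (1 + theta))) = alpha * beta / 80.
  by rewrite /beta [in LHS]invfM mulrA mulrAC.
have ip : 0 < #|I|%:R :> R by rewrite ltr0n.
set i := #|I|%:R in xP ip *; set n := #|V|%:R.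
set m := #|M|%:R in aM xP.
have minP : i * (n - i) <= n * (minn #|I| (#|V| - #|I|))%:R.
  rewrite /i /n -natrB // -!natrM ler_nat.
  by move: nI; move: #|V| #|I| => a b ab; rewrite /minn; case: ifP => _;
     [rewrite mulnC leq_mul // leq_subr | rewrite leq_mul].
have n0 : 0 <= n by rewrite ler0n.
clearbody beta x i n m.
(* The pairs are worth at least [beta / 2] each and at most [8 + 2] times the decrease in total,
   hence 20; the factor 4 in [aM] turns it into 80. *)
have h1 : m * beta <= 20 * (i ^+ 2 * (i^-1 - x)) by lra.
have h2 : alpha * beta / 80 * (i * (n - i)) <= n * (i ^+ 2 * (i^-1 - x)).
  apply: (@le_trans _ _ (alpha * beta / 80 * (n * (minn #|I| (#|V| - #|I|))%:R))).
    by rewrite ler_wpM2l // divr_ge0 ?mulr_ge0.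
  have := ler_wpM2l (mulr_ge0 n0 b0) aM.
  have := ler_wpM2l n0 h1.
  by lra.
have id : i ^+ 2 * ((1 - alpha * beta / 80) * (n * i^-1 - 1) - (n * x - 1))
    = n * (i ^+ 2 * (i^-1 - x)) - alpha * beta / 80 * (i * (n - i)).
  by field; rewrite lt0r_neq0.
by rewrite -subr_ge0 -(pmulr_rge0 _ (exprn_gt0 2 ip)) id subr_ge0.
Qed.

End Matching.

(** * Histories *)

Section History.
Variables (R : realType) (V : finType) (G : dyngraph V).
Variables (adv : adversary V) (source : V).
Hypothesis adv_valid : valid_adversary adv.
Implicit Types (I J : {set V}) (p : proposals V) (f : {set V} -> R).

(* Uninformed nodes send nothing and informed nodes only address uninformed ones,
   so every addressed node gets informed, whatever the adversary accepts. *)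
Lemma next_spread (g : cgraph V) I p a : valid_acceptances p a ->
  ppush_round_law R g I p != 0 -> ppush_next I a = spread I p.
Proof.
move=> pa law0.
have node0 l : node_law R g I l (p l) != 0.
  by apply: contra law0 => /eqP l0; rewrite /ppush_round_law (bigD1 l) //= [X in X * _]l0 mul0r.
have pI u v : p u = Some v -> (u \in I) && (v \notin I).
  move=> puv; have := node0 u; rewrite node_lawE puv.
  case: ifP => [/andP[uI _]|_]; last by rewrite eqxx.
  by rewrite uI inE; case: (v \in I) => //; rewrite andbF mul0r eqxx.
apply/setP => v; rewrite !inE; case: (boolP (v \in I)) => //= vI.
apply/existsP/existsP => -[u /andP[uI]].
  rewrite /linked => /orP[/eqP auv|/eqP avu].
    exists u; rewrite uI /=; apply/eqP.
    by have := pa v; rewrite auv => -[].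
  have := pa u; rewrite avu => -[_ /pI/andP[]].
  by rewrite (negbTE vI).
move=> /eqP puv.
have pv : p v = None.
  by case E : (p v) => [w|] //; have /andP[] := pI _ _ E; rewrite (negbTE vI).
have := pa v; case E : (a v) => [w|].
  move=> [_ /pI/andP[wI _]]; exists w; rewrite wI /linked E eqxx //.
by case=> // /(_ u).
Qed.

(** The outermost operator is the earliest round, so the argument is the informed set before round
    [s]. *)
Fixpoint run (s k : nat) f : {set V} -> R :=
  if k is k'.+1 then ppush_step (G s) (run s.+1 k' f) else f.

Lemma runD s j k f : run s (j + k) f = run s j (run (s + j) k f).
Proof.
elim: j s => [|j IH] s; first by rewrite addn0.
by rewrite addSn /= IH addSnnS.
Qed.

Lemma sum_tupleS T (F : seq (proposals V) -> R) :
  \sum_(h : T.+1.-tuple (proposals V)) F h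
  = \sum_(h : T.-tuple (proposals V)) \sum_p F (p :: h).
Proof.
rewrite pair_big /=.
rewrite (reindex (fun x : T.-tuple (proposals V) * proposals V => [tuple of x.2 :: x.1])) //=.
exists (fun h => (behead_tuple h, thead h)) => [[h p] _|h _] /=.
  by congr pair; apply: val_inj.
by rewrite -tuple_eta.
Qed.

(** The adversary disappears from the right-hand side. Induction peels off the last round, the head
    of the history; proposals of probability zero contribute nothing. *)
Lemma history_law_run T f :
  \sum_(h : T.-tuple (proposals V))
     ppush_history_law R G adv source h * f (ppush_informed adv source h)
  = run 0 T f [set source].
Proof.
elim: T f => [|T IH] f.
  rewrite (big_pred1 [tuple]) /= ?mul1r // => h.
  by apply/esym/eqP; rewrite (tuple0 h); apply: val_inj.
rewrite -addn1 runD -IH addn1.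
rewrite (sum_tupleS _ (fun h => ppush_history_law R G adv source h
   * f (ppush_informed adv source h))).
apply: eq_bigr => h _; rewrite /= /ppush_step add0n mulr_sumr.
apply: eq_bigr => p _; rewrite -mulrA size_tuple; congr (_ * _).
have [->|p0] := eqVneq (ppush_round_law R (G T) (ppush_informed adv source h) p) 0.
  by rewrite !mul0r.
by rewrite (next_spread _ p0).
Qed.

Lemma le_run s k f (f' : {set V} -> R) I :
  (forall J, I \subset J -> f J <= f' J) -> run s k f I <= run s k f' I.
Proof.
elim: k s I => [|k IH] s I fg /=; first exact: fg.
apply: le_ppush_step => J IJ _; apply: IH => K JK.
exact/fg/(subset_trans IJ).
Qed.

Lemma runZ s k (a : R) f I : run s k (fun J => a * f J) I = a * run s k f I.
Proof.
elim: k s I => [//|k IH] s I /=; rewrite -ppush_stepZ.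
by congr (ppush_step _ _ _); apply/funext => J.
Qed.

Lemma eq_ppush_step (g g' : cgraph V) f : g =2 g' -> ppush_step g f = ppush_step g' f.
Proof.
move=> gg; apply/funext => I; apply: eq_bigr => p _; congr (_ * _).
apply: eq_bigr => l _; congr ppush_law.
by apply/funext => u; rewrite /view gg.
Qed.

Lemma run_stable s k f : (forall j, (j < k)%N -> G (s + j)%N =2 G s) ->
  run s k f = iter k (ppush_step (G s)) f.
Proof.
move: (G s) => g; elim: k s => [//|k IH] s st; rewrite iterS /=.
rewrite (IH s.+1); last by move=> j jk; rewrite addSnnS; apply: st.
by apply: eq_ppush_step; have := st 0%N isT; rewrite addn0.
Qed.

(* The intervals of stability need not be aligned with the rounds [s],
   [s + 2 * tau], and so on; among any [2 * tau] rounds, [tau] consecutive ones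
   share their topology. *)
Lemma stable_window tau s : (0 < tau)%N -> stability_at_least G tau ->
  exists2 d, (d <= tau)%N & forall j, (j < tau)%N -> G (s + d + j)%N =2 G (s + d)%N.
Proof.
move=> tau0 [t' tt' [t'0 st]].
have [same|diff] := leqP (s %% t' + tau) t'.
  exists 0%N => // j jt; apply: st; rewrite addn0.
  rewrite {1}(divn_eq s t') -addnA divnMDl // [X in (_ + X)%N]divn_small ?addn0 //.
  by apply: leq_trans same; rewrite ltn_add2l.
have lt := ltn_pmod s t'0.
(* The next interval starts within [tau] rounds and lasts [t' >= tau] rounds. *)
exists (t' - s %% t')%N; first by lia.
move=> j jt; apply: st.
have -> : (s + (t' - s %% t') = (s %/ t').+1 * t')%N.
  by rewrite {1}(divn_eq s t') mulSn; lia.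
have jt' := leq_trans jt tt'.
by rewrite divnMDl // mulnK // (divn_small jt') addn0.
Qed.

(** Each block of [2 * tau] rounds contains a stable window, which contracts by [q]; all other
    rounds only use monotonicity. *)
Lemma contract_run tau q f I :
  (0 < tau)%N -> stability_at_least G tau -> 0 <= q ->
  (forall J s, (0 < #|J|)%N -> iter tau (ppush_step (G s)) f J <= q * f J) ->
  (forall J s, (0 < #|J|)%N -> ppush_step (G s) f J <= f J) ->
  (0 < #|I|)%N -> forall s w r, run s (2 * tau * w + r) f I <= q ^+ w * f I.
Proof.
move=> tau0 st q0 contr mono I0.
have sub0 (J K : {set V}) : (0 < #|J|)%N -> J \subset K -> (0 < #|K|)%N.
  by move=> J0 /subset_leq_card; exact: leq_trans J0.
have runmono s k J : (0 < #|J|)%N -> run s k f J <= f J.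
  elim: k s J => [//|k IH] s J J0 /=.
  apply: le_trans (mono J s J0); apply: le_ppush_step => K JK _.
  exact/IH/(sub0 J).
have win s J : (0 < #|J|)%N -> run s (2 * tau) f J <= q * f J.
  move=> J0; have [d dt sd] := stable_window s tau0 st.
  have -> : (2 * tau = d + (tau + (tau - d)))%N by lia.
  rewrite !runD; apply: (@le_trans _ _ (run s d (fun K => q * f K) J)).
    apply: le_run => K JK; have K0 := sub0 _ _ J0 JK.
    apply: le_trans (contr K (s + d)%N K0).
    rewrite -(run_stable _ sd); apply: le_run => L KL.
    exact/runmono/(sub0 K).
  by rewrite runZ ler_wpM2l // runmono.
move=> s w r; elim: w s I I0 => [|w IH] s I I0.
  by rewrite muln0 expr0 mul1r runmono.
rewrite mulnS -addnA runD.
apply: (@le_trans _ _ (run s (2 * tau) (fun K => q ^+ w * f K) I)).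
  by apply: le_run => K IK; apply/IH/(sub0 I).
by rewrite runZ exprSr -mulrA ler_wpM2l ?exprn_ge0 // win.
Qed.

End History.

(** * Expansion and degree *)

Section ExpansionDegree.
Variables (R : realType) (V : finType).
Implicit Types (g : cgraph V) (S : {set V}) (G : dyngraph V).

(** A set with empty boundary is closed under edges, hence everything by connectivity. *)
Lemma boundary_gt0 g S : (0 < #|S|)%N -> (#|S| < #|V|)%N -> (0 < #|boundary g S|)%N.
Proof.
move=> /card_gt0P[x xS] SV; rewrite lt0n cards_eq0; apply/eqP => b0.
have cl : closed g (mem S).
  apply: intro_closed; first exact/sym_connect_sym/edge_sym.
  move=> u v Guv uS; apply: contraT => vS.
  have := in_set0 v; rewrite -b0 inE vS /= => /negbT/existsPn/(_ u).
  by rewrite edge_sym Guv uS.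
suff : S = [set: V] by move=> SE; rewrite SE cardsT ltnn in SV.
apply/setP => y; rewrite inE.
by rewrite -(closed_connect cl (edge_conn g x y)).
Qed.

Hypothesis V2 : (1 < #|V|)%N.

Let half_natE S : (#|S|%:R <= #|V|%:R / 2 :> R) = (2 * #|S| <= #|V|)%N.
Proof. by rewrite ler_pdivlMr // mulrC -natrM ler_nat. Qed.

Lemma vexpansion_le g S : (0 < #|S|)%N -> (2 * #|S| <= #|V|)%N ->
  vexpansion R g <= #|boundary g S|%:R / #|S|%:R.
Proof.
move=> S0 S2; apply: ge_inf; last by exists S; rewrite half_natE.
by exists 0 => _ [S' [_ _ ->]]; rewrite divr_ge0.
Qed.

(** This bound is uniform over graphs, which keeps the infimum over infinitely many rounds
    positive. *)
Lemma vexpansion_ge g : #|V|%:R^-1 <= vexpansion R g.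
Proof.
have [x _] : exists x : V, x \in V by apply/card_gt0P; exact: ltnW.
apply: lb_le_inf.
  exists (#|boundary g [set x]|%:R / #|[set x]|%:R), [set x].
  by rewrite half_natE cards1.
move=> _ [S [S0 + ->]]; rewrite half_natE => S2.
have SV : (#|S| < #|V|)%N by lia.
rewrite -[leLHS]mul1r ler_pM // ?invr_ge0 //.
  by rewrite ler1n boundary_gt0.
by rewrite lef_pV2 ?posrE ?ltr0n ?ler_nat //; lia.
Qed.

Lemma dyn_vexpansion_le G t : dyn_vexpansion R G <= vexpansion R (G t).
Proof.
apply: ge_inf; last by exists t.
by exists #|V|%:R^-1 => _ [s ->]; apply: vexpansion_ge.
Qed.

Lemma dyn_vexpansion_gt0 G : 0 < dyn_vexpansion R G.
Proof.
apply: (@lt_le_trans _ _ #|V|%:R^-1); first by rewrite invr_gt0 ltr0n ltnW.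
apply: lb_le_inf; first by exists (vexpansion R (G 0%N)), 0%N.
by move=> _ [s ->]; apply: vexpansion_ge.
Qed.

Lemma dyn_vexpansion_boundary G t S : (0 < #|S|)%N -> (2 * #|S| <= #|V|)%N ->
  dyn_vexpansion R G * #|S|%:R <= #|boundary (G t) S|%:R.
Proof.
move=> S0 S2; rewrite -ler_pdivlMr ?ltr0n //.
exact: le_trans (dyn_vexpansion_le G t) (vexpansion_le _ S0 S2).
Qed.

(** Tested on a set of [#|V|./2] nodes, whose complement is at most twice as large. *)
Lemma dyn_vexpansion_le2 G : dyn_vexpansion R G <= 2.
Proof.
have hV : (#|V|./2 <= #|V|)%N by lia.
pose S := [set x in take #|V|./2 (enum V)].
have cS : #|S| = #|V|./2.
  rewrite cardsE (card_uniqP _) ?take_uniq ?enum_uniq // size_takel //.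
  by rewrite -cardE.
have S0 : (0 < #|S|)%N by rewrite cS; lia.
have S2 : (2 * #|S| <= #|V|)%N by rewrite cS; lia.
have := dyn_vexpansion_boundary G 0 S0 S2.
rewrite -ler_pdivlMr ?ltr0n // => /le_trans; apply.
rewrite ler_pdivrMr ?ltr0n // -natrM ler_nat.
have bS : boundary (G 0%N) S \subset ~: S.
  by apply/subsetP => v; rewrite !inE => /andP[].
apply: leq_trans (subset_leq_card bS) _.
by have := cardsC S; rewrite cS; lia.
Qed.

Let maxdeg_ub G : has_ubound
  [set x : R | exists t, x = (\max_(v : V) #|[set u | G t v u]|)%:R]%classic.
Proof.
exists #|V|%:R => _ [t ->]; rewrite ler_nat.
by apply/bigmax_leqP => v _; apply: max_card.
Qed.

(* The inner [set u | _] of [dyn_maxdeg] is read as a classical set. *)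
Lemma dyn_maxdeg_ge G t v : #|[set u | G t v u]|%:R <= dyn_maxdeg R G.
Proof.
have -> : #|[set u | G t v u]| = #|[set u | G t v u]%classic|.
  by apply: eq_card => u; rewrite inE; apply/idP/idP; rewrite in_setE.
apply: (@le_trans _ _ (\max_(v : V) #|[set u | G t v u]%classic|)%:R).
  by rewrite ler_nat (leq_bigmax v).
by apply: (ub_le_sup (maxdeg_ub G)); exists t.
Qed.

Lemma dyn_maxdeg_le G : dyn_maxdeg R G <= #|V|%:R.
Proof.
apply: ge_sup; first by exists (\max_(v : V) #|[set u | G 0%N v u]%classic|)%:R, 0%N.
move=> _ [t ->]; rewrite ler_nat.
by apply/bigmax_leqP => v _; apply: max_card.
Qed.

End ExpansionDegree.

(** * From the expected ratio to the success probability *)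

Section Solved.
Variables (R : realType) (V : finType) (G : dyngraph V).
Variables (adv : adversary V) (source : V).
Hypothesis adv_valid : valid_adversary adv.

Lemma run_affine s k (a b : R) f I :
  run G s k (fun J => a + b * f J) I = a + b * run G s k f I.
Proof.
elim: k s I => [//|k IH] s I /=.
rewrite -ppush_stepZ -{2}(ppush_step_const (G s) a I) -ppush_stepD.
by congr (ppush_step _ _ _); apply/funext => J.
Qed.

(** Markov's inequality: the ratio is at least [1 / #|V|] on every unsolved state. *)
Lemma Pr_solved_ge T :
  1 - #|V|%:R * run G 0 T (ratio_uninformed R (V := V)) [set source]
  <= ppush_Pr R G adv source T (ppush_solved adv source).
Proof.
have -> : ppush_Pr R G adv source T (ppush_solved adv source)
   = run G 0 T (fun J => (J == [set: V])%:R) [set source].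
  rewrite -(history_law_run G source adv_valid) /ppush_Pr big_mkcond.
  by apply: eq_bigr => h _; rewrite /ppush_solved; case: eqP; rewrite ?mulr1 ?mulr0.
rewrite -mulNr -run_affine; apply: le_run => J sJ.
have n0 : 0 < #|V|%:R :> R by rewrite ltr0n; apply/card_gt0P; exists source.
rewrite /ratio_uninformed /inv_card.
have [->|nJ] := eqVneq J [set: V].
  by rewrite cardsT divff ?lt0r_neq0 // subrr mulr0 addr0.
have J0 : (0 < #|J|)%N by rewrite (leq_trans _ (subset_leq_card sJ)) // cards1.
have JV : (#|J| < #|V|)%N.
  rewrite ltn_neqAle max_card andbT; apply: contra nJ => /eqP JV.
  by rewrite eqEcard subsetT cardsT JV leqnn.
rewrite mulNr subr_le0 mulrBr mulr1 lerBrDr.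
have jp : 0 < #|J|%:R :> R by rewrite ltr0n.
rewrite mulrA ler_pdivlMr // -(natrD _ 1) -!natrM ler_nat.
by nia.
Qed.

End Solved.

(** * Numerical estimates *)

Section Numerics.
Variable R : realType.

Lemma ln2_le1 : ln 2 <= 1 :> R.
Proof. by have := @le_ln1Dx R 1; apply; lra. Qed.

Lemma ln2_gt0 : 0 < ln 2 :> R.
Proof. by rewrite ln_gt0 // ltr1n. Qed.

Lemma exp2_le_of_log2 (x : R) k : (0 < k)%N -> k%:R <= log2 x -> 2 ^+ k <= x.
Proof.
move=> k0; rewrite /log2 ler_pdivlMr ?ln2_gt0 // => kx.
(* [ln] is 0 on nonpositive reals, which would contradict [0 < k]. *)
have x0 : 0 < x.
  rewrite ltNge; apply/negP => x0; move: kx; rewrite (ln0 x0).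
  by apply/negP; rewrite -ltNge mulr_gt0 ?ln2_gt0 // ltr0n.
have p0 : 0 < 2 ^+ k :> R by rewrite exprn_gt0.
by rewrite -(ler_ln p0 x0) lnXn // -[leLHS]mulr_natl.
Qed.

Lemma ln_le_log2 (x : R) : 1 <= x -> ln x <= log2 x.
Proof.
move=> x1; rewrite /log2 ler_pdivlMr ?ln2_gt0 //.
exact: ler_piMr (ln_ge0 x1) ln2_le1.
Qed.

Lemma log2_ge1 (x : R) : 2 <= x -> 1 <= log2 x.
Proof.
move=> x2; rewrite /log2 ler_pdivlMr ?ln2_gt0 // mul1r.
by rewrite ler_ln ?posrE //; lra.
Qed.

Lemma expr_le_expR (q : R) w : 0 <= q <= 1 -> (1 - q) ^+ w <= expR (- (q * w%:R)).
Proof.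
move=> /andP[q0 q1]; rewrite -mulNr expRM_natr lerXn2r ?nnegrE ?expR_ge0 //.
  by rewrite subr_ge0.
exact: expR_ge1Dx.
Qed.

(** The factor 2 provides the strict inequality required by [window_contracts]. *)
Lemma powR_natinv_gt (x : R) k : 0 < x -> (0 < k)%N ->
  x < (2 * x `^ (1 / k%:R)) ^+ k.
Proof.
move=> x0 k0; rewrite exprMn.
have -> : (x `^ (1 / k%:R)) ^+ k = x.
  rewrite -powR_mulrn ?powR_ge0 // -powRrM div1r mulVf ?powRr1 ?ltW //.
  by rewrite pnatr_eq0 -lt0n.
by rewrite ltr_pMl // exprn_egt1 ?ltr1n // -lt0n.
Qed.

End Numerics.

Theorem theorem3 (R : realType) (c : R) (hc : 1 <= c) :
  exists2 C : R, 0 < C &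
    forall (V : finType) (G : dyngraph V) (tau : nat) (source : V)
           (adv : adversary V),
      let n : R := #|V|%:R in
      let alpha : R := dyn_vexpansion R G in
      let Delta : R := dyn_maxdeg R G in
      valid_adversary adv ->
      stability_at_least G tau ->
      (1 <= tau)%N ->
      tau%:R <= log2 Delta ->
      forall T : nat,
        C * ((1 / alpha) * Delta `^ (1 / tau%:R) * tau%:R * log2 n ^+ 3)
          <= T%:R ->
        1 - n `^ (- c)
          <= ppush_Pr R G adv source T (ppush_solved adv source).
Proof.
(* 1280 is 2 for blocks of [2 * tau] rounds, times 640 from [qL]. In [c + 3], 2 pays for the factor
   [n ^+ 2] and 1 for rounding down the number of blocks. *)
exists (1280 * (c + 3)); first by lra.
move=> V G tau source adv n alpha Delta adv_valid st tau0 tauD T hT.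
have D2 : 2 ^+ tau <= Delta by apply: exp2_le_of_log2.
have Dn : Delta <= n by apply: dyn_maxdeg_le.
have Delta1 : 1 <= Delta by apply: le_trans D2; rewrite exprn_ege1 // ler1n.
have tauV : (2 ^ tau <= #|V|)%N by rewrite -(ler_nat R) natrX (le_trans D2).
have V2 : (1 < #|V|)%N by rewrite (leq_trans _ tauV) // -{1}(expn1 2) leq_exp2l.
have n2 : 2 <= n by rewrite ler_nat.
have n0 : 0 < n by lra.
have a0 : 0 < alpha by apply: dyn_vexpansion_gt0.
have a2 : alpha <= 2 by apply: dyn_vexpansion_le2.
set L := log2 n in hT; have L1 : 1 <= L by apply: log2_ge1.
have lnL : ln n <= L by apply: ln_le_log2; lra.
have ln0' : 0 <= ln n by apply: ln_ge0; lra.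
set P := Delta `^ (1 / tau%:R) in hT.
have P1 : 1 <= P by rewrite /P -[leLHS](powRr0 Delta) ler_powR // div1r invr_ge0.
pose q := alpha / (80 * (2 * P * (1 + 3 * ln n))).
have P0 : 0 < P by lra.
have den1 : 1 <= 2 * P * (1 + 3 * ln n).
  by rewrite -[leLHS]mulr1 ler_pM //; lra.
have q0 : 0 <= q by rewrite divr_ge0 // ?ltW //; lra.
have q1 : q <= 1 by rewrite ler_pdivrMr ?mul1r; lra.
have contract (J : {set V}) s : (0 < #|J|)%N ->
    iter tau (ppush_step (G s)) (ratio_uninformed R (V := V)) J
    <= (1 - q) * ratio_uninformed R J.
  move=> J0; apply: window_contracts => //.
  - by rewrite a2 ltW.
  - by rewrite mulr_ge0.
  - by lra.
  - by move=> S S0 S2; apply: dyn_vexpansion_boundary.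
  - move=> l; apply: (@le_lt_trans _ _ Delta); first exact: dyn_maxdeg_ge.
    by apply: powR_natinv_gt => //; lra.
  (* For [theta = 3 * ln n] the error is [tau / n ^+ 2 <= 1 / n <= 1 / 2]. *)
  rewrite expRN expRM_natl lnK ?posrE //.
  have -> : tau%:R * (n * (n ^+ 3)^-1) = tau%:R / n / n :> R.
    by field; rewrite lt0r_neq0.
  apply: (@le_trans _ _ (1 / n)); last by rewrite div1r lef_pV2 ?posrE.
  rewrite ler_wpM2r ?invr_ge0 ?(ltW n0) // ler_pdivrMr // mul1r ler_nat.
  by apply: leq_trans tauV; apply/ltnW/ltn_expl.
have mono (J : {set V}) s : (0 < #|J|)%N ->
    ppush_step (G s) (ratio_uninformed R (V := V)) J <= ratio_uninformed R J.
  move=> J0; rewrite -[X in X <= _]/(iter 1 _ _ J) iter_ratio /=.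
  by rewrite lerB // ler_wpM2l // inv_card_step_le.
have src0 : (0 < #|[set source]|)%N by rewrite cards1.
pose w := (T %/ (2 * tau))%N.
have q1' : 0 <= 1 - q by rewrite subr_ge0.
have := contract_run tau0 st q1' contract mono src0 0 w (T %% (2 * tau)).
rewrite mulnC -divn_eq => small.
apply: le_trans (Pr_solved_ge R G source adv_valid T).
rewrite lerB // -/n.
apply: le_trans (ler_wpM2l (ltW n0) small) _.
rewrite /ratio_uninformed /inv_card cards1 invr1 mulr1 -/n.
apply: (@le_trans _ _ (n * (expR (- (q * w%:R)) * n))).
  rewrite ler_wpM2l ?(ltW n0) // ler_pM ?exprn_ge0 //; first by lra.
    by rewrite expr_le_expR ?q0.
  by lra.
have nE : n = expR (ln n) by rewrite lnK ?posrE.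
rewrite /powR gt_eqF // {1 2}nE mulrCA -!expRD ler_expR.
have tau0' : 0 < tau%:R :> R by rewrite ltr0n.
have Tw : T%:R <= 2 * tau%:R * (w%:R + 1) :> R.
  rewrite natr1 -!natrM ler_nat mulnC ltnW //.
  by rewrite ltn_ceil // muln_gt0.
have qL : alpha <= q * (640 * P * L).
  rewrite /q mulrAC ler_pdivlMr; last by lra.
  rewrite ler_wpM2l ?(ltW a0) //.
  have : P * (1 + 3 * ln n) <= P * (4 * L) by rewrite ler_wpM2l ?(ltW P0) //; lra.
  by lra.
have wL : 640 * (c + 3) * P * L ^+ 3 <= alpha * (w%:R + 1).
  have k0 : 0 < 2 * tau%:R / alpha by rewrite divr_gt0 // mulr_gt0.
  have an0 : alpha != 0 by rewrite gt_eqF.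
  have lhsE : 2 * tau%:R / alpha * (640 * (c + 3) * P * L ^+ 3)
      = 1280 * (c + 3) * (1 / alpha * P * tau%:R * L ^+ 3) by field.
  have rhsE : 2 * tau%:R / alpha * (alpha * (w%:R + 1))
      = 2 * tau%:R * (w%:R + 1) by field.
  by rewrite -(ler_pM2l k0) lhsE rhsE (le_trans hT).
have key : (c + 3) * L <= q * (w%:R + 1).
  have w0 : 0 <= w%:R + 1 :> R by rewrite addr_ge0.
  have PL0 : 0 < 640 * P * L.
    by rewrite mulr_gt0 ?(lt_le_trans ltr01 L1) // mulr_gt0 // ltr0n.
  (* Cancelling [640 * P * L] in [wL] leaves [L ^+ 2], which is at least [L]. *)
  apply: (@le_trans _ _ ((c + 3) * L ^+ 2)).
    by rewrite ler_wpM2l ?expr2 ?ler_peMl //; lra.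
  rewrite -(ler_pM2l PL0).
  have := ler_wpM2r w0 qL.
  by lra.
have : (c + 2) * ln n <= (c + 2) * L by rewrite ler_wpM2l //; lra.
lra.
Qed.
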